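(* A geodesic in a proper geodesic metric space is $D$-contracting if and only if it is $D'$-super-contracting, where $D$ and $D'$ determine each other. Precisely: (i) for every $D\ge 0$ there exists $D'\ge 0$, depending only on $D$, such that for every proper geodesic metric space $X$, every $D$-contracting geodesic $\alpha$ in $X$ is $D'$-super-contracting; and (ii) for every $D'\ge 0$ there exists $D\ge 0$, depending only on $D'$, such that for every proper geodesic metric space $X$, every $D'$-super-contracting geodesic $\alpha$ in $X$ is $D$-contracting.
   Context: Geodesics are isometric embeddings of closed intervals of $\mathbb{R}$ (possibly infinite), and a path is also identified with its image. For a closed subset $C$ of a proper geodesic metric space $X$ and $x\in X$, the projection of $x$ is the set $\pi_C(x)=\{p\in C : d(x,p)=\min_{y\in C} d(x,y)\}$ (possibly more than one point); for $B\subseteq X$, $\pi_C(B)=\bigcup_{x\in B}\pi_C(x)$. A geodesic $\alpha$ is $D$-contracting if for every closed metric ball $B$ disjoint from $\alpha$, $\operatorname{diam}(\pi_\alpha(B))\le D$. A geodesic $\alpha$ is $D$-super-contracting if every subsegment of $\alpha$ is $D$-contracting, i.e. for every subsegment $\gamma\subseteq\alpha$ and every closed metric ball $B$ disjoint from $\gamma$, $\operatorname{diam}(\pi_\gamma(B))\le D$. *)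

(* Defs.v *)
From HB Require Import structures.
From mathcomp Require Import all_boot all_order all_algebra.
From mathcomp Require Import all_classical all_reals all_analysis.

Set Implicit Arguments.
Unset Strict Implicit.
Unset Printing Implicit Defensive.

Import Order.TTheory GRing.Theory Num.Theory.
Import numFieldNormedType.Exports.

Local Open Scope classical_set_scope.
Local Open Scope ring_scope.

(* Not the library's [closed_ball], which is the closure of the open ball. *)
Definition metric_closed_ball (R : realType) (X : metricType R) (x : X) (r : R)
    : set X :=
  [set y | mdist x y <= r].

Definition proper_space (R : realType) (X : metricType R) : Prop :=
  forall (x : X) (r : R), compact (metric_closed_ball x r).

Definition closed_interval (R : realType) (I : set R) : Prop :=
  [/\ I !=set0, is_interval I & closed I].

(* A geodesic is the restriction to [I] of a total function [f]; the values of
   [f] outside [I] are irrelevant. *)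
Definition geodesic (R : realType) (X : metricType R) (I : set R) (f : R -> X)
    : Prop :=
  closed_interval I /\
  forall s t : R, I s -> I t -> mdist (f s) (f t) = `|s - t|.

Definition geodesic_space (R : realType) (X : metricType R) : Prop :=
  forall x y : X, exists (a b : R) (f : R -> X),
    [/\ a <= b, geodesic `[a, b] f, f a = x & f b = y].

Definition proj_pt (R : realType) (X : metricType R) (C : set X) (x : X)
    : set X :=
  [set p | C p /\ forall y : X, C y -> mdist x p <= mdist x y].

Definition proj (R : realType) (X : metricType R) (C B : set X) : set X :=
  \bigcup_(x in B) proj_pt C x.

(* [-oo] on the empty set, [+oo] on unbounded sets. *)
Definition diam (R : realType) (X : metricType R) (A : set X) : \bar R :=
  ereal_sup [set (mdist p q)%:E | p in A & q in A].

Definition contracting (R : realType) (X : metricType R) (D : R) (C : set X)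
    : Prop :=
  forall (x : X) (r : R), 0 <= r ->
    metric_closed_ball x r `&` C = set0 ->
    (diam (proj C (metric_closed_ball x r)) <= D%:E)%E.

Definition contracting_geodesic (R : realType) (X : metricType R) (D : R)
    (I : set R) (f : R -> X) : Prop :=
  contracting D (f @` I).

(* Subsegments are the restrictions of [f] to nonempty closed subintervals of
   [I], bounded or not. *)
Definition super_contracting_geodesic (R : realType) (X : metricType R) (D : R)
    (I : set R) (f : R -> X) : Prop :=
  forall J : set R, closed_interval J -> J `<=` I ->
    contracting_geodesic D J f.

(* Main.v *)
(** Walk along a geodesic [xy] from [x]: from a point [u] at distance more than
    [4D] from a [D]-contracting set [C], a step of length [d(u, C) - D] moves the
    projection by at most [D], i.e. by at most a third of the step. As a detour
    via [C] cannot be shorter than the geodesic, either the projections of [x]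
    and [y] are close, or the geodesic passes near the projection [p] of [x].
    Consequently [d(x, z) >= d(x, p) + d(p, z) - O(D)] for [z] in [C], and
    [d(x, y) >= d(x, p) + d(p, q) - O(D)] when [p], [q] are far apart.

    Now let [C] be a geodesic and [J] a subsegment of it. By the first inequality,
    the projection of [x] to [J] is near the point of [J] closest to [p]. By the
    second one, if [p] and [q] have distant closest points in [J], then
    [d(x, y) >= d(x, J)], so that no ball around [x] disjoint from [J] contains
    [y]. *)
Require Import Defs.
From HB Require Import structures.
From mathcomp Require Import all_boot all_order all_algebra.
From mathcomp Require Import all_classical all_reals all_analysis.
From mathcomp Require Import lra.

Set Implicit Arguments.
Unset Strict Implicit.
Unset Printing Implicit Defensive.

Import Order.TTheory GRing.Theory Num.Theory.
Import numFieldNormedType.Exports.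

Local Open Scope classical_set_scope.
Local Open Scope ring_scope.

Lemma exists_min_lipschitz (R : realType) (A : set R) (a c : R) (g : R -> R) :
  closed A -> A a ->
  (forall s t, A s -> A t -> `|g s - g t| <= `|s - t|) ->
  (forall s, A s -> `|s - a| <= g s + c) ->
  exists2 m, A m & forall t, A t -> g m <= g t.
Proof.
move=> clA Aa lipg coercg.
(* By coercivity, [g] exceeds [g a] on the rest of [A]. *)
pose K := A `&` `[a - (g a + c), a + (g a + c)].
have M0 : 0 <= g a + c by apply: le_trans (coercg _ Aa).
have Ka : K a by split => //=; rewrite in_itv /=; lra.
have cK : compact K.
  by rewrite /K setIC; apply: compact_closedI => //; exact: segment_compact.
have contg : {within K, continuous g}.
  apply/subspace_continuousP => x Kx; apply/cvgrPdist_lt => e e0.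
  rewrite near_withinE; near=> y => Ky.
  apply: le_lt_trans (lipg _ _ Kx.1 Ky.1) _.
  by near: y; exact: cvgr_dist_lt.
have [m mK minm] := compact_EVT_min (ex_intro _ a Ka) cK contg.
move: mK; rewrite inE => Km; exists m; first exact: Km.1.
move=> t At; have [le_tM|lt_Mt] := leP `|t - a| (g a + c).
  apply: minm; rewrite inE; split => //=; rewrite in_itv /=.
  by move: le_tM; rewrite ler_norml; lra.
have := minm a; rewrite inE => /(_ Ka); have := coercg t At; lra.
Unshelve. all: by end_near.
Qed.

Ltac abs_lra :=
  repeat match goal with |- context [ `| ?x | ] => case: (ger0P x) => ? end;
  lra.

(** If [s] lies outside [J], convexity keeps [J] on one side of [s], and [m] is its end on that
    side. *)
Lemma closest_point_interval (R : realType) (J : set R) (s : R) :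
  closed_interval J -> exists2 m, J m &
    forall u, J u -> `|s - u| = `|s - m| + `|m - u|.
Proof.
move=> [[j Jj] itvJ clJ].
have [m Jm minm] : exists2 m, J m & forall t, J t -> `|s - m| <= `|s - t|.
  apply: (@exists_min_lipschitz _ _ j `|s - j|) => //.
  - by move=> u v _ _; apply: le_trans (ler_dist_dist _ _) _;
      rewrite (_ : s - u - (s - v) = v - u) 1?distrC//; lra.
  - by move=> u _; rewrite (distrC s u); exact: ler_distD.
exists m => // u Ju.
have [Js|nJs] := pselect (J s).
  by have := minm s Js; rewrite subrr normr0 normr_le0 subr_eq0 => /eqP ->;
     rewrite subrr normr0 add0r.
have side v w : J v -> J w -> v <= s -> s <= w -> False.
  by move=> Jv Jw vs sw; apply: nJs; apply: (itvJ v w) => //; rewrite vs sw.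
have := minm u Ju; have [sm|ms] := leP s m; have [su|us] := leP s u.
- by abs_lra.
- by case: (side u m); rewrite // ltW.
- by case: (side m u); rewrite // ltW.
- by abs_lra.
Qed.

Lemma between_point (R : realType) (X : metricType R) (x y : X) (t : R) :
  geodesic_space X -> 0 <= t <= mdist x y ->
  exists w, mdist x w = t /\ mdist x w + mdist w y = mdist x y.
Proof.
move=> gX txy; have [a [b [f [ab [_ isof] fa fb]]]] := gX x y.
have dxy : mdist x y = b - a.
  by rewrite -fa -fb isof /= ?in_itv /= ?lexx ?ab // distrC ger0_norm ?subr_ge0.
exists (f (a + t)); rewrite -fa -fb !isof /= ?in_itv /= ?lexx ?ab //; try lra.
move: txy => /andP[t0]; rewrite dxy => tb.
by split; abs_lra.
Qed.

Lemma mdist_diam_le (R : realType) (X : metricType R) (A : set X) (D : R) :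
  (diam A <= D%:E)%E <-> forall p q, A p -> A q -> mdist p q <= D.
Proof.
split=> [leD p q Ap Aq|leD].
  rewrite -lee_fin; apply: le_trans leD; apply: ereal_sup_ubound.
  by exists p => //; exists q.
by apply: ge_ereal_sup => _ [p Ap [q Aq <-]]; rewrite lee_fin leD.
Qed.

Section Contracting.
Variables (R : realType) (X : metricType R) (D : R) (C : set X).
Hypotheses (gX : geodesic_space X).
Hypotheses (projC : forall x, proj_pt C x !=set0) (contrC : contracting D C).

(** The closed ball around [y] through [z] misses [C], so contraction applies to it. *)
Lemma contracting_proj_close (y z q q' : X) :
  proj_pt C y q -> proj_pt C z q' -> mdist y z < mdist y q -> mdist q q' <= D.
Proof.
move=> yq zq' yzq.
have disj : metric_closed_ball y (mdist y z) `&` C = set0.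
  rewrite -subset0 => c []; rewrite /metric_closed_ball /= => ycz Cc.
  by have := yq.2 c Cc; lra.
have /mdist_diam_le := contrC (mdist_ge0 y z) disj; apply.
  by exists y => //=; rewrite /metric_closed_ball /= mdistxx mdist_ge0.
by exists z => //=; rewrite /metric_closed_ball /=.
Qed.

Lemma contracting_walk (y z q : X) : 1 <= D -> proj_pt C y q ->
  exists y' q', [/\ mdist y y' + mdist y' z = mdist y z, proj_pt C y' q',
    mdist q q' <= mdist y y' / 3 &
    mdist y' q' <= 4 * D \/ mdist y' z < mdist y' q' - D].
Proof.
(* Each step of the walk is longer than [3 * D >= 3], so the bound [n] drops by at least one. *)
move=> D1; have [n] : exists n : nat, mdist y z < n%:R.
  by exists (Num.truncn (mdist y z)).+1; exact: truncnS_gt.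
elim: n y q => [|n IHn] y q; first by have := mdist_ge0 y z; lra.
move=> yzn yq; have [near|far] := leP (mdist y q) (4 * D).
  by exists y, q; rewrite !mdistxx; split=> //; [lra|left].
have [end_|step] := ltP (mdist y z) (mdist y q - D).
  by exists y, q; rewrite !mdistxx; split=> //; [lra|right].
have [|w [yw ywz]] := @between_point _ _ y z (mdist y q - D) gX.
  by apply/andP; split; lra.
have [q1 wq1] := projC w.
have [|y' [q' [wy'z y'q' q1q' stop]]] := IHn w q1 _ wq1.
  by move: yzn; rewrite -natr1; lra.
have qq1 : mdist q q1 <= D by apply: contracting_proj_close yq wq1 _; lra.
exists y', q'; split=> //.
  by have := metric_triangle y w y'; have := metric_triangle y y' z; lra.
have := metric_triangle q q1 q'; have := metric_triangle y w y'.
have := metric_triangle y y' z; lra.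
Qed.

Lemma contracting_pass_near (x y p q : X) : 1 <= D ->
  proj_pt C x p -> proj_pt C y q ->
  mdist p q <= 6 * D \/
  exists2 w, mdist x w + mdist w y = mdist x y & mdist p w <= 8 * D.
Proof.
move=> D1 xp yq; have [near|far] := leP (mdist x p) (4 * D).
  right; exists x; first by rewrite mdistxx add0r.
  by rewrite metric_sym; lra.
have [xyp|pxy] := ltP (mdist x y) (mdist x p).
  by left; have := contracting_proj_close xp yq xyp; lra.
have [xyq|qxy] := ltP (mdist x y) (mdist y q - D).
  left; suff : mdist q p <= D by rewrite metric_sym; lra.
  by apply: contracting_proj_close yq xp _; rewrite metric_sym; lra.
(* [z] is short of [y] by about [d(y, C)], so that the detour via [C] bounds
   [d(x, z)] by [d(x, p) + d(p, q) + D] whatever the value of [d(y, C)]. *)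
have [z [xzy qqz zle]] : exists z, [/\ mdist x z + mdist z y = mdist x y,
    forall q', proj_pt C z q' -> mdist q q' <= D &
    mdist x z <= mdist x p + mdist p q + D].
  have tri : mdist x y <= mdist x p + mdist p q + mdist y q.
    have := metric_triangle x p y; have := metric_triangle p q y.
    by rewrite (metric_sym q y); lra.
  have [yq_le|yq_gt] := leP (mdist y q) D.
    exists y; rewrite mdistxx addr0; split=> [//|q' yq'|]; last by lra.
    (* The ball of radius 0 around [y] misses [C] only if [y] is not in [C]; otherwise [q] and [q']
       are both [y]. *)
    have [yq0|yq0] := leP (mdist y q) 0; last first.
      by apply: contracting_proj_close yq yq' _; rewrite mdistxx.
    have := metric_triangle q y q'; have := yq'.2 _ yq.1.
    by rewrite (metric_sym q y); lra.
  have [|z [xz xzy]] := @between_point _ _ x y (mdist x y - (mdist y q - D)) gX.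
    by apply/andP; split; lra.
  exists z; split=> // [q' zq'|]; last by lra.
  by apply: contracting_proj_close yq zq' _; rewrite metric_sym; lra.
have [qz zqz] := projC z.
have := qqz _ zqz; rewrite (metric_sym q qz) => qzq.
have [xz_lt|xz_ge] := ltP (mdist x z) (mdist x p - D).
  left; have := contracting_proj_close xp zqz; have := metric_triangle p qz q.
  by move=> ? /(_ ltac:(lra)) ?; lra.
have [|u [xu xuz]] := @between_point _ _ x z (mdist x p - D) gX.
  by apply/andP; split; lra.
have [qu uqu] := projC u.
have pqu : mdist p qu <= D by apply: contracting_proj_close xp uqu _; lra.
have [w [q' [uwz wq' quq' [near|end_]]]] := contracting_walk z D1 uqu.
  (* As [w] lies beyond [u] on the geodesic, [d(u, w) <= d(p, w) + D]. The walk gives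
     [d(p, w) <= 5D + d(u, w)/3], and the factor 1/3 lets [d(p, w)] be absorbed. *)
  right; exists w.
    have := metric_triangle x u w; have := metric_triangle x w z.
    have := metric_triangle x w y; have := metric_triangle w z y; lra.
  have := metric_triangle p qu q'; have := metric_triangle p q' w.
  have := metric_triangle x p w; have := metric_triangle x u w.
  have := metric_triangle x w z; rewrite (metric_sym q' w); lra.
(* The same absorption: [d(p, q) <= 3D + d(u, w)/3], while the choice of [z] gives
   [d(u, w) <= d(p, q) + 2D]. *)
left.
have q'qz : mdist q' qz <= D by apply: contracting_proj_close wq' zqz _; lra.
have := metric_triangle p qu q'; have := metric_triangle p q' qz.
have := metric_triangle p qz q; have := mdist_ge0 w z; lra.
Qed.

Lemma contracting_dist_to_set (x p z : X) : 1 <= D ->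
  proj_pt C x p -> C z ->
  mdist x p + mdist p z - 16 * D <= mdist x z.
Proof.
move=> D1 xp Cz; have zz : proj_pt C z z.
  (* With [z] as its own projection, passing within [8 * D] of [p] costs twice that. *)
  by split=> // y _; rewrite mdistxx mdist_ge0.
have [pz|[w xwz pw]] := contracting_pass_near D1 xp zz.
  by have := xp.2 _ Cz; lra.
have := metric_triangle x w p; have := metric_triangle p w z.
by rewrite (metric_sym w p); lra.
Qed.

Lemma contracting_dist_proj (x y p q : X) : 1 <= D ->
  proj_pt C x p -> proj_pt C y q ->
  mdist p q <= 6 * D \/ mdist x p + mdist p q - 32 * D <= mdist x y.
Proof.
move=> D1 xp yq; have [|[w xwy pw]] := contracting_pass_near D1 xp yq; first by left.
(* The loss of [32 * D] is [16 * D] for the detour from [w] to [p] and [16 * D] for comparing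
   [d(y, p)] with [d(y, q) + d(q, p)]. *)
right; have := contracting_dist_to_set D1 yq xp.1; have := mdist_ge0 y q.
have := metric_triangle x w p; have := metric_triangle p w y.
by rewrite (metric_sym w p) (metric_sym y p) (metric_sym q p); lra.
Qed.

End Contracting.

Lemma geodesic_proj_nonempty (R : realType) (X : metricType R) (I : set R)
    (f : R -> X) (x : X) : geodesic I f -> proj_pt (f @` I) x !=set0.
Proof.
move=> [[[a Ia] _ clI] isof].
have [|s Is|m Im minm] :=
    @exists_min_lipschitz _ I a (mdist x (f a)) (fun s => mdist x (f s)) clI Ia.
- move=> s t Is It; rewrite -(isof s t) // ler_norml.
  have := metric_triangle x (f s) (f t); have := metric_triangle x (f t) (f s).
  by rewrite (metric_sym (f t)); lra.
- rewrite -(isof s a) //; have := metric_triangle (f s) x (f a).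
  by rewrite (metric_sym (f s) x).
by exists (f m); split=> [|_ [t It <-]]; [exists m|exact: minm].
Qed.

Lemma contracting_geodesic_subsegment (R : realType) (X : metricType R) (D : R)
    (I J : set R) (f : R -> X) :
  geodesic_space X -> 1 <= D -> geodesic I f -> contracting_geodesic D I f ->
  closed_interval J -> J `<=` I -> contracting_geodesic (96 * D) J f.
Proof.
move=> gX D1 gf contr cJ JI.
have projI x := geodesic_proj_nonempty x gf.
have isof := gf.2.
(* Going from [y] to [f m] via [f s] is at least as long as going to the closest point [f u], which
   by [contracting_dist_to_set] nearly goes via [f s] too. *)
have proj_near y s m u : I s -> proj_pt (f @` I) y (f s) -> J m ->
    (forall v, J v -> `|s - v| = `|s - m| + `|m - v|) ->
    J u -> proj_pt (f @` J) y (f u) -> `|m - u| <= 16 * D.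
  move=> Is ys Jm clm Ju yu.
  have := contracting_dist_to_set gX projI contr D1 ys (imageP f (JI _ Ju)).
  have := yu.2 _ (imageP f Jm); have := metric_triangle y (f s) (f m).
  by rewrite !isof ?(clm u) //; auto; lra.
move=> x r r0 disj.
have far m : J m -> r < mdist x (f m).
  move=> Jm; rewrite ltNge; apply/negP => xm.
  by have : set0 (f m) by rewrite -disj; split => //; exists m.
have [p xs] := projI x; have [s Is fs] := xs.1; rewrite -{p}fs in xs.
have [ms Jms clms] := closest_point_interval s cJ.
suff near_ms y u : metric_closed_ball x r y -> J u ->
    proj_pt (f @` J) y (f u) -> `|ms - u| <= 48 * D.
  apply/mdist_diam_le => p q [y By yp] [z Bz zq].
  have [u Ju fu] := yp.1; have [v Jv fv] := zq.1; move: yp zq; rewrite -fu -fv.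
  move=> /(near_ms _ _ By Ju) ? /(near_ms _ _ Bz Jv) ?.
  rewrite isof; [|exact: JI..].
  by have := ler_distD ms u v; rewrite (distrC u ms); lra.
move=> By Ju yu.
have [q yt] := projI y; have [t It ft] := yt.1; rewrite -{q}ft in yt.
have [mt Jmt clmt] := closest_point_interval t cJ.
have tu := proj_near _ _ _ _ It yt Jmt clmt Ju yu.
(* The constants add up as [48 = 32 + 16], doubled to 96 for two points of the ball. *)
suff : `|ms - mt| <= 32 * D by have := ler_distD mt ms u; lra.
have [->|ms_mt] := eqVneq ms mt; first by rewrite subrr normr0; lra.
(* Distinct closest points are met in the order [s], [ms], [mt], [t] on the line. *)
have st : `|s - ms| + `|ms - mt| <= `|s - t|.
  have := clms _ Jmt; have := clmt _ Jms; move: ms_mt; rewrite neq_lt; clear.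
  rewrite (distrC mt ms); abs_lra.
have := contracting_dist_proj gX projI contr D1 xs yt.
have := far _ Jms; have := metric_triangle x (f s) (f ms).
rewrite !isof //; [|exact: JI]; move: By; rewrite /metric_closed_ball /=.
have := ler_distD ms s mt; have := normr_ge0 (s - ms).
by move=> ? ? ? ? ? [] ?; lra.
Qed.

Theorem theorem1p1 (R : realType) :
  (forall D : R, 0 <= D -> exists2 D' : R, 0 <= D' &
     forall X : metricType R, proper_space X -> geodesic_space X ->
     forall (I : set R) (f : R -> X), geodesic I f ->
       contracting_geodesic D I f -> super_contracting_geodesic D' I f)
  /\
  (forall D' : R, 0 <= D' -> exists2 D : R, 0 <= D &
     forall X : metricType R, proper_space X -> geodesic_space X ->
     forall (I : set R) (f : R -> X), geodesic I f ->
       super_contracting_geodesic D' I f -> contracting_geodesic D I f).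
Proof.
split=> D D0.
  (* [D + 1] meets the requirement [1 <= D] of the walk. *)
  exists (96 * (D + 1)); first lra.
  move=> X _ gX I f gf contr J cJ JI.
  apply: (@contracting_geodesic_subsegment _ _ _ I) => //; first lra.
  move=> x r r0 disj; apply: le_trans (contr x r r0 disj) _.
  by rewrite lee_fin; lra.
by exists D => // X _ _ I f [cI _] sup; exact: sup.
Qed.
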